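(* Let $\mathcal{L}$ be a subspace lattice on a Banach space $X$ over $\mathbb{K}\in\{\mathbb{R},\mathbb{C}\}$ such that $\vee\{F:F\in\mathcal{J}(\mathcal{L})\}=X$ or $\wedge\{L_-:L\in\mathcal{J}(\mathcal{L})\}=(0)$. If $\delta:\mathrm{alg}\mathcal{L}\to B(X)$ is a linear map satisfying $(m+n+l)\delta(A^2)=m\delta(A)A+nA\delta(A)+lA\delta(I)A$ for all $A\in\mathrm{alg}\mathcal{L}$, then $\delta(AB)=\delta(A)B=A\delta(B)$ for all $A,B\in\mathrm{alg}\mathcal{L}$.
   Context: Fixed integers $m,n,l\ge 0$ satisfy $m+l\ge1$ and $n+l\ge1$. A subspace lattice $\mathcal{L}$ on $X$ is a collection of closed subspaces containing $(0)$ and $X$ and closed under arbitrary intersections and closed linear spans; $\mathrm{alg}\mathcal{L}$ is the algebra of bounded operators leaving every member of $\mathcal{L}$ invariant. For $E\in\mathcal{L}$, $E_-=\vee\{F\in\mathcal{L}:F\not\supseteq E\}$; $\mathcal{J}(\mathcal{L})=\{K\in\mathcal{L}:K\ne(0),\ K_-\ne X\}$. *)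

(* Defs.v *)
From Stdlib Require Import Reals.
Open Scope R_scope.

Record Cpx := mkC { re : R; im : R }.

Inductive Kind := KReal | KComplex.

Definition scal (k : Kind) : Type :=
  match k with KReal => R | KComplex => Cpx end.

Definition sadd (k : Kind) : scal k -> scal k -> scal k :=
  match k with
  | KReal => fun a b => a + b
  | KComplex => fun a b => mkC (re a + re b) (im a + im b)
  end.

Definition smul (k : Kind) : scal k -> scal k -> scal k :=
  match k with
  | KReal => fun a b => a * b
  | KComplex => fun a b =>
      mkC (re a * re b - im a * im b) (re a * im b + im a * re b)
  end.

Definition sone (k : Kind) : scal k :=
  match k with KReal => 1 | KComplex => mkC 1 0 end.

Definition sabs (k : Kind) : scal k -> R :=
  match k with
  | KReal => fun a => Rabs a
  | KComplex => fun a => sqrt (re a * re a + im a * im a)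
  end.

Definition snat (k : Kind) (n : nat) : scal k :=
  match k return scal k with
  | KReal => INR n
  | KComplex => mkC (INR n) 0
  end.

Record Banach (k : Kind) := {
  car :> Type;
  vzero : car;
  vadd : car -> car -> car;
  vopp : car -> car;
  vscale : scal k -> car -> car;
  vnorm : car -> R;
  vadd_assoc : forall x y z, vadd x (vadd y z) = vadd (vadd x y) z;
  vadd_comm : forall x y, vadd x y = vadd y x;
  vadd_0 : forall x, vadd x vzero = x;
  vadd_opp : forall x, vadd x (vopp x) = vzero;
  vscale_1 : forall x, vscale (sone k) x = x;
  vscale_mul : forall a b x, vscale a (vscale b x) = vscale (smul k a b) x;
  vscale_addv : forall a x y, vscale a (vadd x y) = vadd (vscale a x) (vscale a y);
  vscale_adds : forall a b x, vscale (sadd k a b) x = vadd (vscale a x) (vscale b x);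
  vnorm_ge0 : forall x, 0 <= vnorm x;
  vnorm_eq0 : forall x, vnorm x = 0 -> x = vzero;
  vnorm_scale : forall a x, vnorm (vscale a x) = sabs k a * vnorm x;
  vnorm_triangle : forall x y, vnorm (vadd x y) <= vnorm x + vnorm y;
  vcomplete : forall u : nat -> car,
    (forall eps, eps > 0 -> exists N, forall p q, (p >= N)%nat -> (q >= N)%nat ->
        vnorm (vadd (u p) (vopp (u q))) < eps) ->
    exists x, Un_cv (fun j => vnorm (vadd (u j) (vopp x))) 0
}.

Arguments vzero {k} _.
Arguments vadd {k _}.
Arguments vopp {k _}.
Arguments vscale {k _}.
Arguments vnorm {k _}.

Section Ops.
Context {k : Kind} (X : Banach k).

Definition subspace (M : X -> Prop) : Prop :=
  M (vzero X) /\ (forall x y, M x -> M y -> M (vadd x y)) /\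
  (forall a x, M x -> M (vscale a x)).

(* sequentially (= topologically, in a normed space) closed *)
Definition closed (M : X -> Prop) : Prop :=
  forall (u : nat -> X) (x : X), (forall j, M (u j)) ->
    Un_cv (fun j => vnorm (vadd (u j) (vopp x))) 0 -> M x.

Definition closed_subspace (M : X -> Prop) : Prop := subspace M /\ closed M.

Definition cspan (F : (X -> Prop) -> Prop) : X -> Prop :=
  fun x => forall M, closed_subspace M ->
    (forall E, F E -> forall y, E y -> M y) -> M x.

Definition cap (F : (X -> Prop) -> Prop) : X -> Prop :=
  fun x => forall E, F E -> E x.

Definition zero_sp : X -> Prop := fun x => x = vzero X.
Definition full_sp : X -> Prop := fun _ => True.

Definition subspace_lattice (Lat : (X -> Prop) -> Prop) : Prop :=
  (forall E, Lat E -> closed_subspace E) /\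
  Lat zero_sp /\ Lat full_sp /\
  (forall F, (forall E, F E -> Lat E) -> Lat (cap F)) /\
  (forall F, (forall E, F E -> Lat E) -> Lat (cspan F)).

Definition Eminus (Lat : (X -> Prop) -> Prop) (E : X -> Prop) : X -> Prop :=
  cspan (fun F => Lat F /\ ~ (forall x, E x -> F x)).

Definition Jset (Lat : (X -> Prop) -> Prop) (K : X -> Prop) : Prop :=
  Lat K /\ (exists x, K x /\ x <> vzero X) /\ (exists x, ~ Eminus Lat K x).

Definition bounded_linear (T : X -> X) : Prop :=
  (forall x y, T (vadd x y) = vadd (T x) (T y)) /\
  (forall a x, T (vscale a x) = vscale a (T x)) /\
  (exists C, forall x, vnorm (T x) <= C * vnorm x).

Definition algL (Lat : (X -> Prop) -> Prop) (A : X -> X) : Prop :=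
  bounded_linear A /\ forall E, Lat E -> forall x, E x -> E (A x).

End Ops.

(* Main.v *)
Require Import Defs.
From Stdlib Require Import Reals Lra Lia Ring Classical FunctionalExtensionality.
From Stdlib Require Import IndefiniteDescription.
From mathcomp Require boolp classical_sets.

(* Put D = delta(I). Subtracting the identity for A from the one for A + I gives
   (p + q) delta(A) = p D A + q A D with p = m + l and q = n + l both positive;
   substituting this back yields D A^2 + A^2 D = 2 A D A. For K in J(L), x in K and
   f in the annihilator of K_-, the rank one operator x (x) f lies in alg L.
   Inserting these operators shows that D acts as a scalar on each vector of each
   K in J(L) if J(L) spans X, and that f o D is a multiple of f for each f
   annihilating some K_- if these K_- intersect to (0). In both cases D commutes
   with alg L, so delta(A) = D A = A D.

   Functionals come from the Hahn-Banach theorem, proved by taking a minimal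
   sublinear functional. They separate points, so a vector identity can be checked
   after applying an arbitrary functional, where it becomes a scalar one. *)

Set Bullet Behavior "Strict Subproofs".

(** * Scalar arithmetic and absolute values, uniformly over the two fields *)

Definition szero (k : Kind) : scal k :=
  match k with KReal => 0 | KComplex => mkC 0 0 end.

Definition sopp (k : Kind) : scal k -> scal k :=
  match k with
  | KReal => fun a => - a
  | KComplex => fun a => mkC (- re a) (- im a)
  end.

Definition ssub (k : Kind) (a b : scal k) : scal k := sadd k a (sopp k b).

Definition sreal (k : Kind) : R -> scal k :=
  match k return R -> scal k with
  | KReal => fun t => t
  | KComplex => fun t => mkC t 0
  end.

Lemma Cpx_eq (a b : Cpx) : re a = re b -> im a = im b -> a = b.
Proof. destruct a, b; simpl; congruence. Qed.

Lemma scal_ring (k : Kind) :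
  ring_theory (szero k) (sone k) (sadd k) (smul k) (ssub k) (sopp k) eq.
Proof.
  destruct k; split; intros; try reflexivity;
    unfold ssub; simpl in *; try ring; apply Cpx_eq; simpl; ring.
Qed.

Lemma sinv_ex (k : Kind) (a : scal k) :
  a <> szero k -> exists b, smul k b a = sone k.
Proof.
  destruct k; simpl; intro Ha.
  - exists (/ a). now field.
  - assert (Hn : re a * re a + im a * im a <> 0).
    { intro E. apply Ha. apply Cpx_eq; simpl; nra. }
    exists (mkC (re a / (re a * re a + im a * im a))
                (- im a / (re a * re a + im a * im a))).
    apply Cpx_eq; simpl; field; assumption.
Qed.

Lemma sreal_add (k : Kind) (s t : R) :
  sreal k (s + t) = sadd k (sreal k s) (sreal k t).
Proof. destruct k; [reflexivity | apply Cpx_eq; simpl; ring]. Qed.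

Lemma sreal_mul (k : Kind) (s t : R) :
  sreal k (s * t) = smul k (sreal k s) (sreal k t).
Proof. destruct k; [reflexivity | apply Cpx_eq; simpl; ring]. Qed.

Lemma sreal_1 (k : Kind) : sreal k 1 = sone k.
Proof. now destruct k. Qed.

Lemma sreal_0 (k : Kind) : sreal k 0 = szero k.
Proof. now destruct k. Qed.

Lemma sreal_opp (k : Kind) (t : R) : sreal k (- t) = sopp k (sreal k t).
Proof. destruct k; [reflexivity | apply Cpx_eq; simpl; ring]. Qed.

Lemma sabs_sreal (k : Kind) (t : R) : sabs k (sreal k t) = Rabs t.
Proof.
  destruct k; [reflexivity|]. simpl.
  replace (t * t + 0 * 0) with (Rsqr t) by (unfold Rsqr; ring).
  apply sqrt_Rsqr_abs.
Qed.

Lemma sabs_mul (k : Kind) (a b : scal k) :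
  sabs k (smul k a b) = sabs k a * sabs k b.
Proof.
  destruct k; simpl; [apply Rabs_mult|].
  rewrite <- sqrt_mult by nra. f_equal. ring.
Qed.

Lemma sabs_ge0 (k : Kind) (a : scal k) : 0 <= sabs k a.
Proof. destruct k; [apply Rabs_pos | apply sqrt_pos]. Qed.

Lemma sabs_eq0 (k : Kind) (a : scal k) : sabs k a = 0 -> a = szero k.
Proof.
  destruct k; simpl; intro E.
  - apply NNPP. intro Ha. now apply (Rabs_no_R0 a).
  - apply sqrt_eq_0 in E; [|nra]. apply Cpx_eq; simpl; nra.
Qed.

Lemma sabs_opp1 (k : Kind) : sabs k (sopp k (sone k)) = 1.
Proof.
  rewrite <- sreal_1, <- sreal_opp, sabs_sreal, Rabs_left; lra.
Qed.

Lemma sabs_triangle (k : Kind) (a b : scal k) :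
  sabs k (sadd k a b) <= sabs k a + sabs k b.
Proof.
  destruct k; simpl; [apply Rabs_triang|].
  pose proof (sqrt_cauchy (re a) (im a) (re b) (im b)) as H. unfold Rsqr in H.
  assert (Ha := sqrt_pos (re a * re a + im a * im a)).
  assert (Hb := sqrt_pos (re b * re b + im b * im b)).
  assert (Ea := sqrt_sqrt (re a * re a + im a * im a) ltac:(nra)).
  assert (Eb := sqrt_sqrt (re b * re b + im b * im b) ltac:(nra)).
  apply Rsqr_incr_0_var; [|lra].
  rewrite Rsqr_sqrt by (apply Rplus_le_le_0_compat; apply Rle_0_sqr).
  unfold Rsqr.
  set (u := sqrt _) in *. set (v := sqrt _) in *. nra.
Qed.

Lemma snat_sreal (k : Kind) (n : nat) : snat k n = sreal k (INR n).
Proof. now destruct k. Qed.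

Lemma snat_add (k : Kind) (p q : nat) :
  snat k (p + q) = sadd k (snat k p) (snat k q).
Proof. rewrite !snat_sreal, plus_INR. apply sreal_add. Qed.

Lemma snat_neq0 (k : Kind) (n : nat) : (1 <= n)%nat -> snat k n <> szero k.
Proof.
  intros Hn E. apply (not_0_INR n); [lia|].
  destruct k; [exact E | exact (f_equal re E)].
Qed.

Lemma sone_neq0 (k : Kind) : sone k <> szero k.
Proof.
  rewrite <- sreal_1, <- sreal_0. destruct k; simpl; intro E; [lra|].
  injection E; lra.
Qed.

(** * The Hahn-Banach theorem *)

Declare Scope vec_scope.
Delimit Scope vec_scope with V.
Declare Scope scal_scope.
Delimit Scope scal_scope with S.

Section BanachSpace.
Context {k : Kind} (X : Banach k).

Local Notation "x + y" := (@vadd k X x y) : vec_scope.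
Local Notation "- x" := (@vopp k X x) : vec_scope.
Local Notation "a *: x" := (@vscale k X a x) (at level 40) : vec_scope.
Local Notation "'0v'" := (vzero X).
Local Notation "a + b" := (sadd k a b) : scal_scope.
Local Notation "a * b" := (smul k a b) : scal_scope.
Local Notation "a - b" := (ssub k a b) : scal_scope.
Local Notation "- a" := (sopp k a) : scal_scope.
Local Notation "'0s'" := (szero k).
Local Notation "'1s'" := (sone k).

Add Ring scal_ring_inst : (scal_ring k).

Lemma smul_cancel (c a b : scal k) : c <> 0s -> (c * a = c * b)%S -> a = b.
Proof.
  intros Hc E. destruct (sinv_ex k c Hc) as [d Hd].
  transitivity (d * c * a)%S; [rewrite Hd; ring|].
  transitivity (d * (c * a))%S; [ring|].
  rewrite E. transitivity (d * c * b)%S; [ring | rewrite Hd; ring].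
Qed.

Lemma vadd_cancel_l (x y z : X) : (x + y = x + z)%V -> y = z.
Proof.
  intro E. rewrite <- (vadd_0 k X y), <- (vadd_0 k X z), <- (vadd_opp k X x).
  rewrite !(vadd_assoc k X), (vadd_comm k X y), (vadd_comm k X z), E.
  reflexivity.
Qed.

Lemma vscale_0l (x : X) : (0s *: x)%V = 0v.
Proof.
  apply (vadd_cancel_l (0s *: x)%V). rewrite vadd_0, <- vscale_adds.
  f_equal. ring.
Qed.

Lemma vscale_0r (a : scal k) : (a *: 0v)%V = 0v.
Proof.
  apply (vadd_cancel_l (a *: 0v)%V). rewrite vadd_0, <- vscale_addv.
  now rewrite vadd_0.
Qed.

Lemma vopp_scale (x : X) : (- x)%V = ((- 1s)%S *: x)%V.
Proof.
  apply (vadd_cancel_l x). rewrite vadd_opp.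
  rewrite <- (vscale_1 k X x) at 1. rewrite <- vscale_adds.
  replace (1s + - 1s)%S with 0s by ring. now rewrite vscale_0l.
Qed.

(** Restricts scalars to the reals, so that one real Hahn-Banach argument serves both fields. *)
Definition rscale (t : R) (x : X) : X := (sreal k t *: x)%V.

Lemma rscale_add (t : R) (x y : X) :
  rscale t (x + y)%V = (rscale t x + rscale t y)%V.
Proof. apply vscale_addv. Qed.

Lemma rscale_comp (s t : R) (x : X) : rscale s (rscale t x) = rscale (s * t) x.
Proof. unfold rscale. now rewrite vscale_mul, sreal_mul. Qed.

Lemma rscale_plus (s t : R) (x : X) :
  rscale (s + t) x = (rscale s x + rscale t x)%V.
Proof. unfold rscale. now rewrite sreal_add, vscale_adds. Qed.

Lemma rscale_1 (x : X) : rscale 1 x = x.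
Proof. unfold rscale. now rewrite sreal_1, vscale_1. Qed.

Lemma rscale_0 (x : X) : rscale 0 x = 0v.
Proof. unfold rscale. now rewrite sreal_0, vscale_0l. Qed.

Lemma rscale_opp1 (x : X) : rscale (-1) x = (- x)%V.
Proof.
  unfold rscale. rewrite vopp_scale. f_equal.
  change (-1) with (-(1)). now rewrite sreal_opp, sreal_1.
Qed.

Lemma vopp_add (x y : X) : (- (x + y) = - x + - y)%V.
Proof. rewrite !vopp_scale. apply vscale_addv. Qed.

Lemma vopp_opp (x : X) : (- - x = x)%V.
Proof.
  rewrite <- !rscale_opp1, rscale_comp.
  replace (-1 * -1) with 1 by ring. apply rscale_1.
Qed.

Lemma rscale_vopp (t : R) (x : X) : rscale t (- x)%V = (- rscale t x)%V.
Proof. rewrite <- !rscale_opp1, !rscale_comp. f_equal. ring. Qed.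

Lemma vadd_shuffle (a b c d : X) : (a + b + (c + d) = a + c + (b + d))%V.
Proof.
  rewrite <- !vadd_assoc. f_equal. rewrite !vadd_assoc. f_equal. apply vadd_comm.
Qed.

Lemma vnorm_rscale (t : R) (x : X) : vnorm (rscale t x) = Rabs t * vnorm x.
Proof. unfold rscale. now rewrite vnorm_scale, sabs_sreal. Qed.

Lemma vnorm_opp (x : X) : vnorm (- x)%V = vnorm x.
Proof. rewrite <- rscale_opp1, vnorm_rscale, Rabs_left by lra. ring. Qed.

Definition sublinear (q : X -> R) : Prop :=
  (forall x y, q (x + y)%V <= q x + q y) /\
  (forall t x, 0 <= t -> q (rscale t x) <= t * q x).

Lemma sublinear_0 (q : X -> R) : sublinear q -> q 0v = 0.
Proof.
  intros [Ha Hs]. apply Rle_antisym.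
  - rewrite <- (rscale_0 0v) at 1. specialize (Hs 0 0v). lra.
  - specialize (Ha 0v 0v). rewrite vadd_0 in Ha. lra.
Qed.

Lemma sublinear_opp (q : X -> R) (x : X) : sublinear q -> 0 <= q x + q (- x)%V.
Proof.
  intro Hq. rewrite <- (sublinear_0 q Hq), <- (vadd_opp k X x). apply Hq.
Qed.

(** A convex cone of constraints: a pair [C u r] asks the functional under construction to be at
    least [r] at [u]. *)
Definition cone (C : X -> R -> Prop) : Prop :=
  C 0v 0 /\
  (forall u v r s, C u r -> C v s -> C (u + v)%V (r + s)) /\
  (forall t u r, 0 < t -> C u r -> C (rscale t u) (t * r)).

Lemma inf_ex (S : R -> Prop) (b : R) :
  (exists r, S r) -> (forall r, S r -> b <= r) ->
  exists i, (forall r, S r -> i <= r) /\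
            (forall c, (forall r, S r -> c <= r) -> c <= i).
Proof.
  intros [r0 Hr0] Hb.
  destruct (completeness (fun r => S (- r))) as [s [Hs1 Hs2]].
  - exists (- b). intros r Hr. specialize (Hb _ Hr). lra.
  - exists (- r0). now rewrite Ropp_involutive.
  - exists (- s). split.
    + intros r Hr. assert (- r <= s); [|lra].
      apply Hs1. now rewrite Ropp_involutive.
    + intros c Hc. assert (s <= - c); [|lra].
      apply Hs2. intros r Hr. specialize (Hc _ Hr). lra.
Qed.

(* The infimal convolution [x |-> inf (q (x + u) - r)] over the cone. *)
Lemma sublinear_below_cone (q : X -> R) (C : X -> R -> Prop) :
  sublinear q -> cone C -> (forall u r, C u r -> r <= q u) ->
  exists q', sublinear q' /\ (forall x, q' x <= q x) /\
    (forall u r, C u r -> q' (- u)%V <= - r).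
Proof.
  intros Hq (C0 & Cadd & Cs) HC.
  set (S := fun x v => exists u r, C u r /\ v = q (x + u)%V - r).
  destruct (functional_choice (fun x i => (forall r, S x r -> i <= r) /\
            (forall c, (forall r, S x r -> c <= r) -> c <= i))) as [q' Hq'].
  (* The infimum is finite because [r <= q u <= q (x + u) + q (- x)]. *)
  { intro x. apply (inf_ex _ (- q (- x)%V)).
    - exists (q (x + 0v)%V - 0). exists 0v, 0. auto.
    - intros v (u & r & Hu & ->). specialize (HC u r Hu).
      pose proof (proj1 Hq (x + u)%V (- x)%V) as H.
      replace (x + u + - x)%V with u in H; [lra|].
      now rewrite (vadd_comm k X x u), <- vadd_assoc, vadd_opp, vadd_0. }
  assert (Hle : forall x u r, C u r -> q' x <= q (x + u)%V - r).
  { intros x u r Hu. apply Hq'. now exists u, r. }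
  assert (Hle0 : forall x, q' x <= q x).
  { intro x. specialize (Hle x 0v 0 C0). rewrite vadd_0 in Hle. lra. }
  exists q'. split; [split|split].
  - intros x y.
    assert (q' (x + y)%V - q' x <= q' y); [|lra].
    apply (proj2 (Hq' y)). intros w (v & s & Hv & ->).
    assert (q' (x + y)%V - (q (y + v)%V - s) <= q' x); [|lra].
    apply (proj2 (Hq' x)). intros w (u & r & Hu & ->).
    specialize (Hle (x + y)%V _ _ (Cadd _ _ _ _ Hu Hv)).
    rewrite vadd_shuffle in Hle.
    pose proof (proj1 Hq (x + u)%V (y + v)%V). lra.
  - intros t x [Ht|<-].
    + assert (q' (rscale t x) / t <= q' x) as H.
      { apply (proj2 (Hq' x)). intros w (u & r & Hu & ->).
        specialize (Hle (rscale t x) _ _ (Cs t _ _ Ht Hu)).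
        rewrite <- rscale_add in Hle.
        pose proof (proj2 Hq t (x + u)%V ltac:(lra)).
        apply (Rmult_le_reg_l t); [lra|].
        replace (t * (q' (rscale t x) / t)) with (q' (rscale t x)) by (field; lra).
        lra. }
      apply (Rmult_le_compat_l t) in H; [|lra].
      replace (t * (q' (rscale t x) / t)) with (q' (rscale t x)) in H
        by (field; lra). exact H.
    + rewrite rscale_0. specialize (Hle0 0v). rewrite (sublinear_0 q Hq) in Hle0. lra.
  - exact Hle0.
  (* At [- u] the competitor [(u, r)] has value [q 0 - r = - r]. *)
  - intros u r Hu. specialize (Hle (- u)%V u r Hu).
    rewrite (vadd_comm k X (- u)%V), vadd_opp, (sublinear_0 q Hq) in Hle. lra.
Qed.

Definition real_linear (g : X -> R) : Prop :=
  (forall x y, g (x + y)%V = g x + g y) /\ (forall t x, g (rscale t x) = t * g x).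

(* Lowering [q] along the ray of [y] gives, by minimality, [q (- y) <= - q y]:
   so [q] is odd, hence linear. *)
Lemma minimal_sublinear_linear (q : X -> R) :
  sublinear q ->
  (forall q', sublinear q' -> (forall x, q' x <= q x) -> forall x, q x <= q' x) ->
  real_linear q.
Proof.
  intros Hq Hmin.
  assert (Hodd : forall x, q (- x)%V = - q x).
  { intro y.
    destruct (sublinear_below_cone q
      (fun u r => exists t, 0 <= t /\ u = rscale t y /\ r = t * q y))
      as (q' & Hq' & Hle & Hc).
    - exact Hq.
    - split; [|split].
      + exists 0. rewrite rscale_0. repeat split; lra.
      + intros u v r s (t1 & H1 & -> & ->) (t2 & H2 & -> & ->).
        exists (t1 + t2). rewrite rscale_plus. repeat split; lra.
      + intros t u r Ht (s & Hs & -> & ->). exists (t * s).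
        rewrite rscale_comp. repeat split; nra.
    - intros u r (t & [Ht|<-] & -> & ->).
      (* [sublinear] bounds [q (t y)] only from above; applying it with factor [/ t] to [t y] gives
         the reverse inequality. *)
      + pose proof (proj2 Hq (/ t) (rscale t y)) as H.
        rewrite rscale_comp, Rinv_l, rscale_1 in H by lra.
        assert (0 < / t) by now apply Rinv_0_lt_compat.
        apply (Rmult_le_reg_l (/ t)); [assumption|].
        rewrite <- Rmult_assoc, Rinv_l, Rmult_1_l by lra. apply H; lra.
      + rewrite rscale_0, (sublinear_0 q Hq). lra.
    - assert (q' (- y)%V <= - q y).
      { apply Hc. exists 1. rewrite rscale_1. repeat split; lra. }
      pose proof (Hmin q' Hq' Hle (- y)%V).
      pose proof (sublinear_opp q y Hq). lra. }
  assert (Hpos : forall t x, 0 <= t -> q (rscale t x) = t * q x).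
  { intros t x Ht. apply Rle_antisym; [now apply Hq|].
    pose proof (proj2 Hq t (- x)%V Ht) as H.
    rewrite rscale_vopp, !Hodd in H. lra. }
  split.
  - intros x y. apply Rle_antisym; [apply Hq|].
    pose proof (proj1 Hq (- x)%V (- y)%V) as H.
    rewrite <- vopp_add, !Hodd in H. lra.
  - intros t x. destruct (Rle_or_lt 0 t) as [Ht|Ht]; [now apply Hpos|].
    replace (rscale t x) with (- rscale (- t) x)%V.
    + rewrite Hodd, Hpos; lra.
    + rewrite <- rscale_opp1, rscale_comp. f_equal. ring.
Qed.

(** Transports [ZL_preorder], stated for boolean relations, to propositional ones through
    [asbool]. *)
Lemma zorn_preorder (T : Type) (t0 : T) (Rel : T -> T -> Prop) :
  (forall t, Rel t t) ->
  (forall r s t, Rel r s -> Rel s t -> Rel r t) ->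
  (forall A : T -> Prop,
     (forall s t, A s -> A t -> Rel s t \/ Rel t s) ->
     exists t, forall s, A s -> Rel s t) ->
  exists t, forall s, Rel t s -> Rel s t.
Proof.
  intros Hr Ht Hc.
  assert (E : forall s t, is_true (boolp.asbool (Rel s t)) <-> Rel s t).
  { intros s t. split.
    - exact (ssrbool.elimT (boolp.asboolP _)).
    - exact (ssrbool.introT (boolp.asboolP _)). }
  destruct (@classical_sets.ZL_preorder T t0 (fun s t => boolp.asbool (Rel s t)))
    as [t Hmax].
  - intro t. apply E, Hr.
  - intros s r t H1 H2. apply E. apply (Ht _ r); now apply E.
  - intros A HA. destruct (Hc A) as [t H].
    + intros s t Hs Hst. destruct (HA s t Hs Hst) as [H|H]; [left|right]; now apply E.
    + exists t. intros s Hs. now apply E, H.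
  - exists t. intros s Hs. apply E, Hmax. now apply E.
Qed.

(** Zorn's lemma is applied to the sublinear functionals below [p] with the order reversed. A chain
    is bounded by its pointwise infimum, and a maximal element is a minimal sublinear functional,
    hence linear. *)
Lemma linear_below_sublinear (p : X -> R) :
  sublinear p -> exists g, real_linear g /\ forall x, g x <= p x.
Proof.
  intro Hp.
  set (T := {q : X -> R | sublinear q /\ forall x, q x <= p x}).
  destruct (zorn_preorder T (exist _ p (conj Hp (fun x => Rle_refl (p x))))
    (fun a b => forall x, proj1_sig b x <= proj1_sig a x)) as [[q [Hq Hqp]] Hmin].
  - intros t x. apply Rle_refl.
  - intros r s t H1 H2 x. eapply Rle_trans; [apply H2 | apply H1].
  - intros A HA. destruct (classic (exists a, A a)) as [[a0 Ha0]|Hno].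
    2:{ exists (exist _ p (conj Hp (fun x => Rle_refl (p x)))).
        intros s Hs. exfalso. apply Hno. now exists s. }
    destruct (functional_choice (fun x i =>
      (forall r, (exists a, A a /\ r = proj1_sig a x) -> i <= r) /\
      (forall c, (forall r, (exists a, A a /\ r = proj1_sig a x) -> c <= r) -> c <= i)))
      as [q Hq].
    (* For a member [a] of the chain, [0 <= a x + a (- x) <= a x + p (- x)]. *)
    { intro x. apply (inf_ex _ (- p (- x)%V)).
      - exists (proj1_sig a0 x), a0. auto.
      - intros r (a & Ha & ->). destruct (proj2_sig a) as [Hs Hle].
        pose proof (sublinear_opp _ x Hs). specialize (Hle (- x)%V). lra. }
    assert (Hle : forall a x, A a -> q x <= proj1_sig a x).
    { intros a x Ha. apply Hq. now exists a. }
    assert (Hsub : sublinear q).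
    { split.
      - intros x y.
        assert (q (x + y)%V - q x <= q y); [|lra].
        apply (proj2 (Hq y)). intros r (b & Hb & ->).
        assert (q (x + y)%V - proj1_sig b y <= q x); [|lra].
        apply (proj2 (Hq x)). intros r (a & Ha & ->).
        (* Of the two members [a] and [b], the smaller one is tested at [x + y]; its subadditivity
           bounds both terms at once. *)
        destruct (HA a b Ha Hb) as [H|H].
        + pose proof (Hle b (x + y)%V Hb). specialize (H x).
          pose proof (proj1 (proj1 (proj2_sig b)) x y). lra.
        + pose proof (Hle a (x + y)%V Ha). specialize (H y).
          pose proof (proj1 (proj1 (proj2_sig a)) x y). lra.
      - intros t x [Ht|<-].
        + assert (q (rscale t x) / t <= q x) as H.
          { apply (proj2 (Hq x)). intros r (a & Ha & ->).
            pose proof (Hle a (rscale t x) Ha).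
            pose proof (proj2 (proj1 (proj2_sig a)) t x ltac:(lra)).
            apply (Rmult_le_reg_l t); [lra|].
            replace (t * (q (rscale t x) / t)) with (q (rscale t x)) by (field; lra).
            lra. }
          apply (Rmult_le_compat_l t) in H; [|lra].
          replace (t * (q (rscale t x) / t)) with (q (rscale t x)) in H
            by (field; lra). exact H.
        + rewrite rscale_0. pose proof (Hle a0 0v Ha0) as H.
          rewrite (sublinear_0 _ (proj1 (proj2_sig a0))) in H. lra. }
    assert (Hqp : forall x, q x <= p x).
    { intro x. eapply Rle_trans; [now apply (Hle a0)|]. apply (proj2_sig a0). }
    exists (exist _ q (conj Hsub Hqp)). intros a Ha x. simpl. now apply Hle.
  - exists q. split; [|exact Hqp].
    apply minimal_sublinear_linear; [exact Hq|].
    intros q' Hq' Hle x.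
    assert (Hq'p : forall x, q' x <= p x).
    { intro z. eapply Rle_trans; [apply Hle | apply Hqp]. }
    exact (Hmin (exist _ q' (conj Hq' Hq'p)) Hle x).
Qed.

(** Otherwise points of [M] within [/ (INR j + 1)] of [y] form a sequence converging to [y], which
    closedness puts in [M]. *)
Lemma closed_dist_pos (M : X -> Prop) (y : X) :
  closed X M -> ~ M y ->
  exists d, 0 < d /\ forall z, M z -> d <= vnorm (z + - y)%V.
Proof.
  intros HM Hy. apply NNPP. intro Hno. apply Hy.
  destruct (functional_choice (fun (j : nat) z =>
    M z /\ vnorm (z + - y)%V < / (INR j + 1))) as [u Hu].
  { intro j. apply NNPP. intro Hj. apply Hno. exists (/ (INR j + 1)).
    pose proof (pos_INR j). split; [apply Rinv_0_lt_compat; lra|].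
    intros z Hz. apply Rnot_lt_le. intro. apply Hj. now exists z. }
  apply (HM u); [apply Hu|].
  intros eps Heps. destruct (archimed_cor1 eps Heps) as (N & HN & HN0).
  exists N. intros j Hj. unfold Rdist. rewrite Rminus_0_r.
  rewrite Rabs_right by (apply Rle_ge, vnorm_ge0).
  eapply Rlt_trans; [apply Hu|]. eapply Rle_lt_trans; [|exact HN].
  apply Rinv_le_contravar; [now apply lt_0_INR|].
  apply le_INR in Hj. lra.
Qed.

(** The norm is lowered along the cone generated by [(y, d)] and [M] at level 0, where [d] bounds
    the distance from [y] to [M]. A linear [g] below the result has [g y >= d], and [g >= 0] on
    [M = - M], hence [g = 0] there. *)
Lemma real_hahn_banach (M : X -> Prop) (y : X) :
  closed_subspace X M -> ~ M y ->
  exists g, real_linear g /\ (forall x, g x <= vnorm x) /\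
    (forall x, M x -> g x = 0) /\ g y <> 0.
Proof.
  intros [(M0 & Madd & Ms) Mc] Hy.
  destruct (closed_dist_pos M y Mc Hy) as (d & Hd & Hdist).
  assert (Mr : forall t x, M x -> M (rscale t x)) by (intros; now apply Ms).
  assert (Mopp : forall x, M x -> M (- x)%V).
  { intros x Hx. rewrite <- rscale_opp1. now apply Mr. }
  destruct (sublinear_below_cone (fun x => vnorm x)
    (fun u r => exists t m, 0 <= t /\ M m /\ u = (rscale t y + m)%V /\ r = t * d))
    as (p & Hp & Hpn & Hpc).
  - split; [apply vnorm_triangle|]. intros t x Ht.
    rewrite vnorm_rscale, Rabs_right; lra.
  - split; [|split].
    + exists 0, 0v. rewrite rscale_0, vadd_0. repeat split; auto; lra.
    + intros u v r s (t1 & m1 & H1 & Hm1 & -> & ->) (t2 & m2 & H2 & Hm2 & -> & ->).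
      exists (t1 + t2)%R, (m1 + m2)%V. rewrite rscale_plus.
      repeat split; auto; [lra | apply vadd_shuffle | lra].
    + intros t u r Ht (s & m & Hs & Hm & -> & ->). exists (t * s), (rscale t m).
      rewrite rscale_add, rscale_comp. repeat split; auto; [nra | ring].
  - intros u r (t & m & [Ht|<-] & Hm & -> & ->).
    (* Dividing [t y + m] by [t] gives, up to sign, the difference between [- m / t], a point of
       [M], and [y]. *)
    + assert (H : d <= vnorm (rscale (- / t) m + - y)%V) by now apply Hdist, Mr.
      rewrite <- vnorm_opp, vopp_add, vopp_opp, <- rscale_opp1, rscale_comp in H.
      replace (-1 * - / t) with (/ t) in H by ring.
      replace (rscale t y + m)%V with (rscale t (rscale (/ t) m + y))%V.
      * rewrite vnorm_rscale, Rabs_right by lra. now apply Rmult_le_compat_l; [lra|].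
      * rewrite rscale_add, rscale_comp, Rinv_r, rscale_1 by lra. apply vadd_comm.
    + rewrite Rmult_0_l. apply vnorm_ge0.
  - destruct (linear_below_sublinear p Hp) as (g & Hg & Hgp).
    exists g. split; [exact Hg|]. 
    assert (Hgopp : forall x, g (- x)%V = - g x).
    { intro x. rewrite <- rscale_opp1, (proj2 Hg). ring. }
    assert (HgM : forall x, M x -> 0 <= g x).
    { intros x Hx. pose proof (Hgp (- x)%V). rewrite Hgopp in H.
      assert (p (- x)%V <= - 0); [|lra].
      apply Hpc. exists 0, x. rewrite rscale_0, vadd_comm, vadd_0.
      repeat split; auto; lra. }
    split; [|split].
    + intro x. eapply Rle_trans; [apply Hgp | apply Hpn].
    + intros x Hx. pose proof (HgM x Hx). pose proof (HgM _ (Mopp x Hx)).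
      rewrite Hgopp in *. lra.
    + pose proof (Hgp (- y)%V). rewrite Hgopp in H.
      assert (p (- y)%V <= - d); [|lra].
      apply Hpc. exists 1, 0v. rewrite rscale_1, vadd_0.
      repeat split; auto; lra.
Qed.

Definition functional (f : X -> scal k) : Prop :=
  (forall x y, f (x + y)%V = (f x + f y)%S) /\
  (forall a x, f (a *: x)%V = (a * f x)%S) /\
  (exists C, forall x, sabs k (f x) <= C * vnorm x).

Lemma Rabs_le_vnorm (g : X -> R) (x : X) :
  real_linear g -> (forall z, g z <= vnorm z) -> Rabs (g x) <= vnorm x.
Proof.
  intros Hg Hle. pose proof (Hle x). pose proof (Hle (- x)%V) as H1.
  rewrite vnorm_opp, <- rscale_opp1, (proj2 Hg) in H1. apply Rabs_le. lra.
Qed.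
End BanachSpace.

(* In the complex case the functional is [g x - i g (i x)]. *)
Lemma functional_of_real (k : Kind) (X : Banach k) (M : X -> Prop) (g : X -> R) :
  subspace X M -> real_linear X g -> (forall x, g x <= vnorm x) ->
  (forall x, M x -> g x = 0) ->
  exists f, functional X f /\ (forall x, M x -> f x = szero k) /\
    (forall x, g x <> 0 -> f x <> szero k).
Proof.
  intros (_ & _ & Ms) Hg Hle HM.
  pose proof (fun x => Rabs_le_vnorm X g x Hg Hle) as Hb.
  destruct Hg as [Ha Hs]. unfold rscale in Hs.
  destruct k; simpl in *.
  - exists g. repeat split; auto. exists 1. intro x. rewrite Rmult_1_l. apply Hb.
  - set (J := fun x : X => @vscale KComplex X (mkC 0 1) x).
    assert (HJ : forall x, vnorm (J x) = vnorm x).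
    { intro x. unfold J. rewrite vnorm_scale. simpl.
      replace (0 * 0 + 1 * 1) with 1 by ring. rewrite sqrt_1. ring. }
    exists (fun x => mkC (g x) (- g (J x))). split; [split; [|split]|split].
    + intros x y. unfold J. rewrite vscale_addv, !Ha. simpl. f_equal. ring.
    + intros a x.
      assert (E : forall y, g (@vscale KComplex X a y) = re a * g y + im a * g (J y)).
      { intro y. rewrite <- !Hs, <- Ha. unfold J.
        rewrite vscale_mul. rewrite <- (vscale_adds KComplex). f_equal. f_equal.
        apply Cpx_eq; simpl; ring. }
      assert (EJ : J (@vscale KComplex X a x) = @vscale KComplex X a (J x)).
      { unfold J. rewrite !vscale_mul. f_equal. apply Cpx_eq; simpl; ring. }
      assert (EJJ : g (J (J x)) = - g x).
      { unfold J. rewrite vscale_mul.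
        transitivity (-1 * g x); [|ring]. rewrite <- Hs. f_equal. f_equal.
        apply Cpx_eq; simpl; ring. }
      rewrite EJ, !E, EJJ. apply Cpx_eq; simpl; ring.
    (* Real and imaginary parts are each at most [vnorm x] in absolute value; 2 is a crude bound for
       the modulus. *)
    + exists 2. intro x. simpl.
      pose proof (Hb x) as H1. pose proof (Hb (J x)) as H2. rewrite HJ in H2.
      pose proof (vnorm_ge0 _ X x).
      apply Rsqr_incr_0_var; [|lra].
      rewrite Rsqr_sqrt by nra.
      pose proof (Rsqr_abs (g x)). pose proof (Rsqr_abs (g (J x))).
      pose proof (Rabs_pos (g x)). pose proof (Rabs_pos (g (J x))).
      unfold Rsqr in *. nra.
    + intros x Hx. apply Cpx_eq; simpl; [now apply HM|].
      unfold J. rewrite HM; [ring | now apply Ms].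
    + intros x Hx E. apply Hx. exact (f_equal re E).
Qed.

(** * Bounded functionals and separation of points *)

Section Operators.
Context {k : Kind} (X : Banach k).

Local Notation "x + y" := (@vadd k X x y) : vec_scope.
Local Notation "- x" := (@vopp k X x) : vec_scope.
Local Notation "a *: x" := (@vscale k X a x) (at level 40) : vec_scope.
Local Notation "'0v'" := (vzero X).
Local Notation "a + b" := (sadd k a b) : scal_scope.
Local Notation "a * b" := (smul k a b) : scal_scope.
Local Notation "a - b" := (ssub k a b) : scal_scope.
Local Notation "- a" := (sopp k a) : scal_scope.
Local Notation "'0s'" := (szero k).
Local Notation "'1s'" := (sone k).

Add Ring scal_ring_ops : (scal_ring k).
Local Open Scope scal_scope.

Lemma functional_scale (c : scal k) (f : X -> scal k) :
  functional X f -> functional X (fun x => c * f x).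
Proof.
  intros (Ha & Hs & C & HC). split; [|split].
  - intros x y. rewrite Ha. ring.
  - intros a x. rewrite Hs. ring.
  - exists (sabs k c * C)%R. intro x. rewrite sabs_mul, Rmult_assoc.
    apply Rmult_le_compat_l; [apply sabs_ge0 | apply HC].
Qed.

Lemma functional_add (f h : X -> scal k) :
  functional X f -> functional X h -> functional X (fun x => f x + h x).
Proof.
  intros (Ha & Hs & C & HC) (Ha' & Hs' & C' & HC'). split; [|split].
  - intros x y. rewrite Ha, Ha'. ring.
  - intros a x. rewrite Hs, Hs'. ring.
  - exists (C + C')%R. intro x. eapply Rle_trans; [apply sabs_triangle|].
    specialize (HC x). specialize (HC' x). lra.
Qed.

(** Bounds can be chained through a composition only when the outer constant is nonnegative. *)
Lemma bounded_nonneg (N P : X -> R) (C : R) :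
  (forall x, (0 <= P x)%R) -> (forall x, (N x <= C * P x)%R) ->
  exists C', (0 <= C')%R /\ forall x, (N x <= C' * P x)%R.
Proof.
  intros HP HC. exists (Rabs C). split; [apply Rabs_pos|]. intro x.
  eapply Rle_trans; [apply HC|]. apply Rmult_le_compat_r; [apply HP | apply Rle_abs].
Qed.

Lemma functional_comp (f : X -> scal k) (A : X -> X) :
  functional X f -> bounded_linear X A -> functional X (fun x => f (A x)).
Proof.
  intros (Ha & Hs & C & HC) (Aa & As & C' & HC'). split; [|split].
  - intros x y. now rewrite Aa, Ha.
  - intros a x. now rewrite As, Hs.
  - destruct (bounded_nonneg (fun x => sabs k (f x)) vnorm C (vnorm_ge0 k X) HC)
      as (C1 & H1 & HC1).
    exists (C1 * C')%R. intro x. eapply Rle_trans; [apply HC1|].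
    rewrite Rmult_assoc. now apply Rmult_le_compat_l.
Qed.

Lemma hahn_banach (M : X -> Prop) (y : X) :
  closed_subspace X M -> ~ M y ->
  exists f, functional X f /\ (forall x, M x -> f x = 0s) /\ f y = 1s.
Proof.
  intros HM Hy. destruct (real_hahn_banach X M y HM Hy) as (g & Hg & Hle & HgM & Hgy).
  destruct (functional_of_real k X M g (proj1 HM) Hg Hle HgM) as (f & Hf & HfM & Hf0).
  destruct (sinv_ex k (f y)) as [c Hc]; [now apply Hf0|].
  exists (fun x => c * f x). split; [now apply functional_scale|split; [|exact Hc]].
  intros x Hx. rewrite HfM by exact Hx. ring.
Qed.

Lemma functional_0 (f : X -> scal k) : functional X f -> f 0v = 0s.
Proof.
  intros (_ & Hs & _). rewrite <- (vscale_0l X 0v), Hs. ring.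
Qed.

Lemma functional_opp (f : X -> scal k) (x : X) :
  functional X f -> f (- x)%V = - f x.
Proof. intros (_ & Hs & _). rewrite vopp_scale, Hs. ring. Qed.

Lemma vadd_opp_eq0 (x y : X) : (x + - y)%V = 0v -> x = y.
Proof.
  intro E. apply (vadd_cancel_l X (- y)%V).
  now rewrite (vadd_comm k X _ x), E, (vadd_comm k X _ y), vadd_opp.
Qed.

Lemma zero_sp_closed : closed_subspace X (zero_sp X).
Proof.
  split; [split; [reflexivity|split]|].
  - intros x y -> ->. apply vadd_0.
  - intros a x ->. apply vscale_0r.
  - intros u x Hu Hx. apply vnorm_eq0.
    apply (UL_sequence (fun _ => vnorm x)).
    + intros eps Heps. exists 0%nat. intros. unfold Rdist.
      rewrite Rminus_diag, Rabs_R0. exact Heps.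
    + intros eps Heps. destruct (Hx eps Heps) as [N HN]. exists N. intros j Hj.
      specialize (HN j Hj). rewrite Hu, vadd_comm, vadd_0, vnorm_opp in HN. exact HN.
Qed.

Lemma dual_nonzero (x : X) : x <> 0v -> exists f, functional X f /\ f x = 1s.
Proof.
  intro Hx. destruct (hahn_banach (zero_sp X) x zero_sp_closed Hx)
    as (f & Hf & _ & E). now exists f.
Qed.

Lemma dual_separates (x y : X) :
  (forall f, functional X f -> f x = f y) -> x = y.
Proof.
  intro H. apply vadd_opp_eq0. apply NNPP. intro Hne.
  destruct (dual_nonzero _ Hne) as (f & Hf & E).
  apply (sone_neq0 k). rewrite <- E, (proj1 Hf), functional_opp, (H f Hf) by exact Hf.
  ring.
Qed.

(** * Rank one operators and the operator [D] *)

Definition rank_one (x : X) (f : X -> scal k) : X -> X := fun z => (f z *: x)%V.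

Definition annihilates (f : X -> scal k) (M : X -> Prop) : Prop :=
  functional X f /\ forall x, M x -> f x = 0s.

Lemma rank_one_bounded (x : X) (f : X -> scal k) :
  functional X f -> bounded_linear X (rank_one x f).
Proof.
  intros (Ha & Hs & C & HC). unfold rank_one. split; [|split].
  - intros y z. now rewrite Ha, vscale_adds.
  - intros a z. now rewrite Hs, vscale_mul.
  - exists (C * vnorm x)%R. intro z. rewrite vnorm_scale.
    pose proof (vnorm_ge0 k X x). specialize (HC z). nra.
Qed.

(** Serves as a linear-combination tactic: applied successively to known equations, it turns an
    equality into an identity for [ring]. *)
Lemma eq_of_sub {a b c d : scal k} : a = b -> c - d = a - b -> c = d.
Proof.
  intros Hab Hcd. transitivity (c - d + d); [ring|]. rewrite Hcd, Hab. ring.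
Qed.

Lemma bounded_linear_0 (T : X -> X) : bounded_linear X T -> T 0v = 0v.
Proof.
  intros (_ & Hs & _). rewrite <- (vscale_0l X 0v) at 1.
  now rewrite Hs, vscale_0l.
Qed.

Lemma bounded_linear_id : bounded_linear X (fun x => x).
Proof.
  repeat split. exists 1%R. intro x. rewrite Rmult_1_l. apply Rle_refl.
Qed.

Lemma bounded_linear_add (S T : X -> X) :
  bounded_linear X S -> bounded_linear X T ->
  bounded_linear X (fun x => (S x + T x)%V).
Proof.
  intros (Sa & Ss & C & HC) (Ta & Ts & C' & HC'). split; [|split].
  - intros x y. rewrite Sa, Ta. apply vadd_shuffle.
  - intros a x. now rewrite Ss, Ts, vscale_addv.
  - exists (C + C')%R. intro x. eapply Rle_trans; [apply vnorm_triangle|].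
    specialize (HC x). specialize (HC' x). lra.
Qed.

Lemma bounded_linear_comp (S T : X -> X) :
  bounded_linear X S -> bounded_linear X T -> bounded_linear X (fun x => S (T x)).
Proof.
  intros (Sa & Ss & C & HC) (Ta & Ts & C' & HC'). split; [|split].
  - intros x y. now rewrite Ta, Sa.
  - intros a x. now rewrite Ts, Ss.
  - destruct (bounded_nonneg (fun x => vnorm (S x)) vnorm C (vnorm_ge0 k X) HC)
      as (C1 & H1 & HC1).
    exists (C1 * C')%R. intro x. eapply Rle_trans; [apply HC1|].
    rewrite Rmult_assoc. now apply Rmult_le_compat_l.
Qed.

(** If [f] vanishes along [u], then [sabs k (f x) <= C * vnorm (u N - x)], which is below
    [sabs k (f x)] for large [N] unless [f x] is zero. *)
Lemma functional_ker_closed (f : X -> scal k) :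
  functional X f -> closed_subspace X (fun x => f x = 0s).
Proof.
  intro Hf. pose proof Hf as (Ha & Hs & C0 & HC0).
  destruct (bounded_nonneg (fun x => sabs k (f x)) vnorm C0 (vnorm_ge0 k X) HC0)
    as (C & HC & Hb).
  split; [split; [now apply functional_0|split]|].
  - intros x y Hx Hy. rewrite Ha, Hx, Hy. ring.
  - intros a x Hx. rewrite Hs, Hx. ring.
  - intros u x Hu Hx. apply sabs_eq0. apply Rle_antisym; [|apply sabs_ge0].
    apply Rnot_lt_le. intro Hpos.
    (* [C + 1] keeps the denominator positive even when [C] is 0. *)
    destruct (Hx (sabs k (f x) / (C + 1))%R) as [N HN].
    { apply Rlt_gt, Rdiv_lt_0_compat; lra. }
    specialize (HN N (le_n N)). unfold Rdist in HN. rewrite Rminus_0_r in HN.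
    rewrite Rabs_right in HN by (apply Rle_ge, vnorm_ge0).
    specialize (Hb (u N + - x)%V).
    rewrite Ha, functional_opp, Hu in Hb by exact Hf.
    replace (0s + - f x)%S with ((- 1s) * f x)%S in Hb by ring.
    rewrite sabs_mul, sabs_opp1, Rmult_1_l in Hb.
    apply (Rmult_lt_compat_r (C + 1)) in HN; [|lra].
    unfold Rdiv in HN. rewrite Rmult_assoc, Rinv_l, Rmult_1_r in HN by lra.
    pose proof (vnorm_ge0 k X (u N + - x)%V). lra.
Qed.

Lemma two_neq0 : (1s + 1s)%S <> 0s.
Proof.
  replace (1s + 1s)%S with (snat k 2); [apply snat_neq0; auto|].
  change 2%nat with (1 + 1)%nat. rewrite snat_add. f_equal;
  rewrite snat_sreal; apply sreal_1.
Qed.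

Context (Lat : (X -> Prop) -> Prop) (hLat : subspace_lattice X Lat).

Lemma algL_id : algL X Lat (fun x => x).
Proof. split; [apply bounded_linear_id | auto]. Qed.

Lemma algL_add (A B : X -> X) :
  algL X Lat A -> algL X Lat B -> algL X Lat (fun x => (A x + B x)%V).
Proof.
  intros [HA HAL] [HB HBL]. split; [now apply bounded_linear_add|].
  intros E HE x Hx. destruct (proj1 hLat E HE) as [(_ & Ea & _) _]. 
  apply Ea; [now apply HAL | now apply HBL].
Qed.

Lemma algL_comp (A B : X -> X) :
  algL X Lat A -> algL X Lat B -> algL X Lat (fun x => A (B x)).
Proof.
  intros [HA HAL] [HB HBL]. split; [now apply bounded_linear_comp|].
  intros E HE x Hx. apply HAL; [exact HE|]. now apply HBL.
Qed.

Lemma cspan_sub (F : (X -> Prop) -> Prop) (E : X -> Prop) (x : X) :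
  F E -> E x -> cspan X F x.
Proof. intros HF HE M _ HM. now apply (HM E). Qed.

Lemma Eminus_Lat (K : X -> Prop) : Lat (Eminus X Lat K).
Proof. apply hLat. now intros E [HE _]. Qed.

Lemma Eminus_closed (K : X -> Prop) : closed_subspace X (Eminus X Lat K).
Proof. apply hLat, Eminus_Lat. Qed.

Lemma sub_Eminus (K F : X -> Prop) (x y : X) :
  Lat F -> K x -> ~ F x -> F y -> Eminus X Lat K y.
Proof.
  intros HF Kx nFx Fy. apply (cspan_sub _ F); [|exact Fy].
  split; [exact HF|]. intro H. now apply nFx, H.
Qed.

(** For [E] in the lattice, either [x] is in [E] and so is the range of the operator, or [K] is not
    inside [E], so that [E] lies in the span [K_-] and [f] kills it. *)
Lemma rank_one_algL (K : X -> Prop) (x : X) (f : X -> scal k) :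
  Lat K -> K x -> annihilates f (Eminus X Lat K) -> algL X Lat (rank_one x f).
Proof.
  intros HK Kx [Hf Hann]. split; [now apply rank_one_bounded|].
  intros E HE z Ez. unfold rank_one.
  destruct (proj1 hLat E HE) as [(E0 & _ & Es) _].
  destruct (classic (E x)) as [Ex|nEx].
  - now apply Es.
  - now rewrite Hann, vscale_0l by now apply (sub_Eminus K E x).
Qed.

Lemma annihilates_comp (f : X -> scal k) (A : X -> X) (K : X -> Prop) :
  algL X Lat A -> annihilates f (Eminus X Lat K) ->
  annihilates (fun x => f (A x)) (Eminus X Lat K).
Proof.
  intros [HA HAL] [Hf Hann]. split; [now apply functional_comp|].
  intros x Hx. apply Hann. now apply HAL; [apply Eminus_Lat|].
Qed.

Lemma annihilates_add (f h : X -> scal k) (M : X -> Prop) :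
  annihilates f M -> annihilates h M -> annihilates (fun x => f x + h x) M.
Proof.
  intros [Hf Hann] [Hh Hannh]. split; [now apply functional_add|].
  intros x Hx. rewrite Hann, Hannh by exact Hx. ring.
Qed.

(** The relation says that the double commutator [[[D, A], A]] vanishes. It is applied to delta(I),
    for which [delta_id_double_commutator] supplies it. *)
Context (D : X -> X) (hD : bounded_linear X D).
Context (hDA : forall A, algL X Lat A -> forall x,
  (D (A (A x)) + A (A (D x)) = A (D (A x)) + A (D (A x)))%V).

(** The quadratic relation for [A + B] minus those for [A] and [B]. *)
Lemma polarized (A B : X -> X) (p : X -> scal k) (x : X) :
  algL X Lat A -> algL X Lat B -> functional X p ->
  p (D (A (B x))) + p (D (B (A x))) + p (A (B (D x))) + p (B (A (D x))) =
  (1s + 1s) * (p (A (D (B x))) + p (B (D (A x)))).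
Proof.
  intros HA HB (pa & _). pose proof hD as (Da & _).
  pose proof (f_equal p (hDA _ HA x)) as EA.
  pose proof (f_equal p (hDA _ HB x)) as EB.
  pose proof (f_equal p (hDA _ (algL_add A B HA HB) x)) as EAB.
  pose proof HA as ((Aa & _) & _). pose proof HB as ((Ba & _) & _).
  repeat (rewrite Da in EAB || rewrite Aa in EAB || rewrite Ba in EAB ||
          rewrite pa in EAB).
  rewrite !pa in EA, EB.
  apply (eq_of_sub EAB), (eq_of_sub (eq_sym EA)), (eq_of_sub (eq_sym EB)). ring.
Qed.

Lemma rank_one_square (K : X -> Prop) (x z : X) (f p : X -> scal k) :
  Lat K -> K x -> annihilates f (Eminus X Lat K) -> functional X p ->
  f z * f x * p (D x) + f (D z) * f x * p x = (1s + 1s) * (f z * f (D x) * p x).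
Proof.
  intros HK Kx Hf (pa & ps & _).
  pose proof (f_equal p (hDA _ (rank_one_algL K x f HK Kx Hf) z)) as E.
  destruct Hf as ((fa & fs & _) & _). pose proof hD as (_ & Ds & _).
  unfold rank_one in E.
  repeat (rewrite Ds in E || rewrite fs in E || rewrite ps in E || rewrite pa in E).
  apply (eq_of_sub E). ring.
Qed.

Lemma rank_one_pair (K L : X -> Prop) (x y z : X) (f g p : X -> scal k) :
  Lat K -> K x -> annihilates f (Eminus X Lat K) ->
  Lat L -> L y -> annihilates g (Eminus X Lat L) -> functional X p ->
  f z * g x * p (D y) + g z * f y * p (D x) +
  f (D z) * g x * p y + g (D z) * f y * p x =
  (1s + 1s) * (f z * g (D x) * p y + g z * f (D y) * p x).
Proof.
  intros HK Kx Hf HL Ly Hg Hp.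
  pose proof (polarized _ _ p z (rank_one_algL L y g HL Ly Hg)
    (rank_one_algL K x f HK Kx Hf) Hp) as E.
  destruct Hp as (pa & ps & _).
  destruct Hf as ((fa & fs & _) & _). destruct Hg as ((ga & gs & _) & _).
  pose proof hD as (_ & Ds & _).
  unfold rank_one in E.
  repeat (rewrite Ds in E || rewrite fs in E || rewrite gs in E ||
          rewrite ps in E || rewrite pa in E).
  apply (eq_of_sub E). ring.
Qed.

(** * Eigenvectors and eigenfunctionals of [D] *)

(** In the relation for the rank one operator of [x] and [f], taking [z = x] shows that [D x] is
    [f (D x) / f x] times [x]; taking [p = f] gives the same factor for [f o D]. *)
Lemma eigenpair (K : X -> Prop) (x : X) (f : X -> scal k) :
  Lat K -> K x -> annihilates f (Eminus X Lat K) -> f x <> 0s ->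
  exists c, D x = (c *: x)%V /\ forall z, f (D z) = c * f z.
Proof.
  intros HK Kx Hf Hfx. destruct (sinv_ex k _ Hfx) as [b Hb].
  exists (b * f (D x)).
  assert (HDx : D x = ((b * f (D x)) *: x)%V).
  { apply dual_separates. intros p Hp.
    pose proof (rank_one_square K x x f p HK Kx Hf Hp) as E.
    rewrite (proj1 (proj2 Hp)).
    apply (smul_cancel (f x) _ _ Hfx), (smul_cancel (f x) _ _ Hfx).
    transitivity ((b * f x) * f x * (f (D x) * p x)); [|ring].
    rewrite Hb.
    apply (eq_of_sub E). ring. }
  split; [exact HDx|]. intro z.
  pose proof (rank_one_square K x z f f HK Kx Hf (proj1 Hf)) as E.
  apply (smul_cancel (f x) _ _ Hfx), (smul_cancel (f x) _ _ Hfx).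
  transitivity ((b * f x) * f x * (f (D x) * f z)); [|ring].
  rewrite Hb.
  apply (eq_of_sub E). ring.
Qed.

(** With [f x = 0] and [z = D x], the rank one relation reduces to [2 f(D x)^2 p(x) = 0] for all
    [p]. A nonzero [f (D x)] would thus force [x = 0]. *)
Lemma annihilates_D (K : X -> Prop) (x : X) (f : X -> scal k) :
  Lat K -> K x -> annihilates f (Eminus X Lat K) -> f x = 0s -> f (D x) = 0s.
Proof.
  intros HK Kx Hf Hfx. apply NNPP. intro Hne. apply Hne.
  replace x with 0v.
  - rewrite (bounded_linear_0 D hD). now apply functional_0, (proj1 Hf).
  - symmetry. apply dual_separates. intros p Hp.
    rewrite (functional_0 p Hp).
    pose proof (rank_one_square K x (D x) f p HK Kx Hf Hp) as E.
    apply (smul_cancel (f (D x)) _ _ Hne), (smul_cancel (f (D x)) _ _ Hne).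
    apply (smul_cancel _ _ _ two_neq0).
    rewrite Hfx in E. apply (eq_of_sub (eq_sym E)). ring.
Qed.

(* If every annihilator of [K_-] kills [x], choose [L] in [J] with [L] not inside
   [K_-]; then [K_- <= L_-], so the annihilators of [L_-] kill [x] as well and the
   polarized identity for [x (x) f] and [y (x) g] with [f y = 1] isolates [D x]. *)
Lemma eigenvector_of_cspan (K : X -> Prop) (x : X) :
  (forall z, cspan X (Jset X Lat) z) -> Jset X Lat K -> K x ->
  exists c, D x = (c *: x)%V.
Proof.
  intros Hspan (HK & _ & w & Hw) Kx.
  destruct (classic (Eminus X Lat K x)) as [Hx|Hx].
  2:{ destruct (hahn_banach _ x (Eminus_closed K) Hx) as (f & Hf & Hann & Hfx).
      destruct (eigenpair K x f HK Kx (conj Hf Hann)) as (c & Hc & _).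
      - rewrite Hfx. apply sone_neq0.
      - now exists c. }
  assert (HL : exists L y, Jset X Lat L /\ L y /\ ~ Eminus X Lat K y).
  { apply NNPP. intro Hno. apply Hw. apply Hspan; [apply Eminus_closed|].
    intros L HL y Ly. apply NNPP. intro Hy. apply Hno. now exists L, y. }
  destruct HL as (L & y & (HL & _ & v & Hv) & Ly & Hy).
  destruct (hahn_banach _ y (Eminus_closed K) Hy) as (f & Hf & Hfann & Hfy).
  destruct (hahn_banach _ v (Eminus_closed L) Hv) as (g & Hg & Hgann & Hgv).
  assert (Hfx : f x = 0s) by now apply Hfann.
  assert (Hgx : g x = 0s).
  { apply Hgann. apply (sub_Eminus L (Eminus X Lat K) y); auto. apply Eminus_Lat. }
  assert (HfDx : f (D x) = 0s) by now apply (annihilates_D K).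
  pose proof (fun z p => rank_one_pair K L x y z f g p HK Kx (conj Hf Hfann)
    HL Ly (conj Hg Hgann)) as E.
  (* With [z = y] and [p = f], only [2 g(D x) = 0] survives. *)
  assert (HgDx : g (D x) = 0s).
  { specialize (E y f Hf). rewrite Hfx, Hgx, Hfy, HfDx in E.
    apply (smul_cancel _ _ _ two_neq0). apply (eq_of_sub (eq_sym E)). ring. }
  (* With [z = v] and [g v = f y = 1], the relation becomes
     [p(D x) + g(D v) p(x) = 2 f(D y) p(x)]. *)
  exists ((1s + 1s) * f (D y) - g (D v)).
  apply dual_separates. intros p Hp. specialize (E v p Hp).
  rewrite Hgx, Hgv, Hfy, HgDx in E. rewrite (proj1 (proj2 Hp)).
  apply (eq_of_sub E). ring.
Qed.

(* Choose [L] in [J] with [K] not inside [L_-]. If [K <= L] then [L_- = K_-], so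
   [f] annihilates [L_-] too; otherwise [L <= K_-]. Either way [f] kills [L], and
   the polarized identity isolates [f o D]. *)
Lemma eigenfunctional_of_cap (K : X -> Prop) (f : X -> scal k) :
  (forall z, (forall L, Jset X Lat L -> Eminus X Lat L z) -> z = 0v) ->
  Jset X Lat K -> annihilates f (Eminus X Lat K) ->
  exists c, forall z, f (D z) = c * f z.
Proof.
  intros Hcap (HK & (x0 & Kx0 & Hx0) & _) Hf.
  (* If [f] annihilates some [L_-] without vanishing on [L], [eigenpair] concludes. In the remaining
     case [f] vanishes on every [L] whose [L_-] it annihilates, in particular on [K]. *)
  destruct (classic (exists L x, Lat L /\ annihilates f (Eminus X Lat L) /\
    L x /\ f x <> 0s)) as [(L & x & HL & HfL & Lx & Hfx)|Hno].
  { destruct (eigenpair L x f HL Lx HfL Hfx) as (c & _ & Hc). now exists c. }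
  assert (Hf0 : forall L x, Lat L -> annihilates f (Eminus X Lat L) -> L x -> f x = 0s).
  { intros L x HL HfL Lx. apply NNPP. intro Hfx. apply Hno. now exists L, x. }
  assert (HL : exists L, Jset X Lat L /\ ~ Eminus X Lat L x0).
  { apply NNPP. intro H. apply Hx0, Hcap. intros L HL. apply NNPP. intro Hx.
    apply H. now exists L. }
  destruct HL as (L & (HL & (y & Ly & Hy) & _) & Hx).
  destruct (hahn_banach _ x0 (Eminus_closed L) Hx) as (g & Hg & Hgann & Hgx).
  assert (Hfy : f y = 0s).
  { destruct (classic (L x0)) as [Lx0|nLx0].
    - apply (Hf0 L); auto. split; [apply Hf|]. intros z Hz.
      apply (proj2 Hf).
      apply (sub_Eminus K (Eminus X Lat L) x0); auto. apply Eminus_Lat.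
    - apply (proj2 Hf). apply (sub_Eminus K L x0); auto. }
  assert (Hfx : f x0 = 0s) by now apply (Hf0 K).
  assert (HfDx : f (D x0) = 0s) by now apply (annihilates_D K).
  pose proof (fun z p => rank_one_pair K L x0 y z f g p HK Kx0 Hf
    HL Ly (conj Hg Hgann)) as E.
  (* With [z = x0] and [p = g], only [2 f(D y) = 0] survives. *)
  assert (HfDy : f (D y) = 0s).
  { specialize (E x0 g Hg). rewrite Hfx, Hfy, HfDx, Hgx in E.
    apply (smul_cancel _ _ _ two_neq0). apply (eq_of_sub (eq_sym E)). ring. }
  destruct (dual_nonzero y Hy) as (p & Hp & Hpy).
  (* With [g x0 = p y = 1], the relation becomes [f(z) p(D y) + f(D z) = 2 f(z) g(D x0)]. *)
  exists ((1s + 1s) * g (D x0) - p (D y)). intro z. specialize (E z p Hp).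
  rewrite Hgx, Hfy, HfDy, Hpy in E.
  apply (eq_of_sub E). ring.
Qed.

(** * Common eigenvalues and commutation with the algebra *)

(** Comparing the three equations gives [(d - e) y = (e - c) x]. Either [d = e], and then [e = c]
    because [x] is nonzero, or [y] is a multiple of [x]. *)
Lemma same_eigenvalue (x y : X) (c d e : scal k) :
  x <> 0v -> D x = (c *: x)%V -> D y = (d *: y)%V ->
  D (x + y)%V = (e *: (x + y))%V -> D y = (c *: y)%V.
Proof.
  intros Hx Ex Ey Exy.
  assert (H : forall p, functional X p -> (d - e) * p y = (e - c) * p x).
  { intros p (pa & ps & _). apply (f_equal p) in Exy.
    rewrite (proj1 hD), Ex, Ey, ps, !pa, !ps in Exy.
    apply (eq_of_sub Exy). ring. }
  destruct (classic (d - e = 0s)) as [Hde|Hde].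
  - destruct (dual_nonzero x Hx) as (p & Hp & Hpx). specialize (H p Hp).
    rewrite Hpx, Hde in H.
    replace c with d; [exact Ey|].
    apply (eq_of_sub (eq_sym H)), (eq_of_sub Hde). ring.
  - destruct (sinv_ex k _ Hde) as [b Hb].
    assert (Hy : y = ((b * (e - c)) *: x)%V).
    { apply dual_separates. intros p Hp. rewrite (proj1 (proj2 Hp)).
      apply (smul_cancel _ _ _ Hde). rewrite (H p Hp).
      transitivity ((b * (d - e)) * ((e - c) * p x)); [rewrite Hb|]; ring. }
    rewrite Hy, (proj1 (proj2 hD)), Ex, !vscale_mul. f_equal. ring.
Qed.

(** The argument of [same_eigenvalue] for functionals; the point [w] witnesses that [f] is
    nonzero. *)
Lemma same_eigenvalue_dual (f h : X -> scal k) (w : X) (c d e : scal k) :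
  f w = 1s -> (forall z, f (D z) = c * f z) -> (forall z, h (D z) = d * h z) ->
  (forall z, f (D z) + h (D z) = e * (f z + h z)) ->
  forall z, h (D z) = c * h z.
Proof.
  intros Hw Ef Eh Efh.
  assert (H : forall z, (d - e) * h z = (e - c) * f z).
  { intro z. specialize (Efh z). rewrite Ef, Eh in Efh. apply (eq_of_sub Efh). ring. }
  intro z. destruct (classic (d - e = 0s)) as [Hde|Hde].
  - specialize (H w). rewrite Hw, Hde in H.
    rewrite Eh. f_equal. apply (eq_of_sub (eq_sym H)), (eq_of_sub Hde). ring.
  - apply (smul_cancel _ _ _ Hde). rewrite H, Ef.
    transitivity (c * ((d - e) * h z)); [rewrite H|]; ring.
Qed.

(** For [z] in [K], the vectors [z], [A z] and [z + A z] lie in [K] and are eigenvectors, so [D] has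
    one eigenvalue on [z] and [A z] and commutes with [A] at [z]. Closed kernels extend this from
    the members of J to their closed span. *)
Lemma commutes_of_cspan (A : X -> X) (x : X) :
  (forall z, cspan X (Jset X Lat) z) -> algL X Lat A -> D (A x) = A (D x).
Proof.
  intros Hspan HA. pose proof HA as ((Aa & As & Ab) & HAL).
  assert (HK : forall K z, Jset X Lat K -> K z -> D (A z) = A (D z)).
  { intros K z HK Kz.
    destruct (classic (z = 0v)) as [->|Hz].
    { now rewrite (bounded_linear_0 D hD), (bounded_linear_0 A (proj1 HA)),
        (bounded_linear_0 D hD). }
    assert (KAz : K (A z)) by (apply HAL; [apply HK | exact Kz]).
    assert (KzAz : K (z + A z)%V).
    { destruct (proj1 hLat K (proj1 HK)) as [(_ & Ka & _) _]. now apply Ka. }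
    destruct (eigenvector_of_cspan K _ Hspan HK Kz) as [c Hc].
    destruct (eigenvector_of_cspan K _ Hspan HK KAz) as [d Hd].
    destruct (eigenvector_of_cspan K _ Hspan HK KzAz) as [e He].
    rewrite (same_eigenvalue z (A z) c d e Hz Hc Hd He), Hc. symmetry. apply As. }
  apply dual_separates. intros p Hp.
  assert (Hq : functional X (fun z => p (D (A z)) + (- 1s) * p (A (D z)))).
  { apply functional_add; [|apply (functional_scale (- 1s) (fun z => p (A (D z))))].
    - apply (functional_comp p (fun z => D (A z)) Hp).
      apply bounded_linear_comp; [exact hD | apply HA].
    - apply (functional_comp p (fun z => A (D z)) Hp).
      apply bounded_linear_comp; [apply HA | exact hD]. }
  pose proof (Hspan x _ (functional_ker_closed _ Hq)) as H. cbv beta in H.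
  apply (fun z => eq_of_sub (H z)); [|ring].
  intros K HJ z Kz. rewrite (HK K z HJ Kz). ring.
Qed.

(** If [D (A x) - A (D x)] were outside some [K_-], a functional [f] killing [K_-] would be 1 there.
    But [f], [f o A] and their sum are eigenfunctionals with a common [c], so both [f (D (A x))] and
    [f (A (D x))] equal [c * f (A x)]. *)
Lemma commutes_of_cap (A : X -> X) (x : X) :
  (forall z, (forall L, Jset X Lat L -> Eminus X Lat L z) -> z = 0v) ->
  algL X Lat A -> D (A x) = A (D x).
Proof.
  intros Hcap HA. apply vadd_opp_eq0. apply Hcap. intros K HK.
  apply NNPP. intro Hne.
  destruct (hahn_banach _ _ (Eminus_closed K) Hne) as (f & Hf & Hann & Hf1).
  assert (Hfa : annihilates f (Eminus X Lat K)) by now split.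
  pose proof (annihilates_comp f A K HA Hfa) as Hha.
  destruct (eigenfunctional_of_cap K _ Hcap HK Hfa) as [c Hc].
  destruct (eigenfunctional_of_cap K _ Hcap HK Hha) as [d Hd].
  destruct (eigenfunctional_of_cap K _ Hcap HK (annihilates_add _ _ _ Hfa Hha))
    as [e He].
  pose proof (same_eigenvalue_dual f (fun z => f (A z)) _ c d e Hf1 Hc Hd He x) as H.
  cbv beta in H.
  rewrite (proj1 Hf), functional_opp, Hc, H in Hf1 by exact Hf.
  apply (sone_neq0 k). rewrite <- Hf1. ring.
Qed.

End Operators.

(** * From the Jordan-type identity to relations for delta(I) *)

Section JordanCentralizer.
Context {k : Kind} (X : Banach k) (m n l : nat) (Lat : (X -> Prop) -> Prop).
Context (hLat : subspace_lattice X Lat).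
Context (delta : (X -> X) -> (X -> X)).
Context (hdB : forall A, algL X Lat A -> bounded_linear X (delta A)).
Context (hdadd : forall A B, algL X Lat A -> algL X Lat B ->
  forall x, delta (fun y => vadd (A y) (B y)) x = vadd (delta A x) (delta B x)).
Context (hid : forall A, algL X Lat A -> forall x,
     vscale (snat k (m + n + l)) (delta (fun y => A (A y)) x) =
     vadd (vscale (snat k m) (delta A (A x)))
       (vadd (vscale (snat k n) (A (delta A x)))
             (vscale (snat k l) (A (delta (fun y => y) (A x)))))).

Local Notation "a + b" := (sadd k a b) : scal_scope.
Local Notation "a * b" := (smul k a b) : scal_scope.
Local Notation "a - b" := (ssub k a b) : scal_scope.
Add Ring scal_ring_jordan : (scal_ring k).
Local Open Scope scal_scope.

Let D := delta (fun y => y).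

(* The identity for [A + I] minus the identity for [A]. *)
Lemma delta_linearized (A : X -> X) (x : X) (p : X -> scal k) :
  algL X Lat A -> functional X p ->
  (snat k (m + l) + snat k (n + l)) * p (delta A x) =
  snat k (m + l) * p (D (A x)) + snat k (n + l) * p (A (D x)).
Proof.
  intros HA (pa & ps & _).
  pose proof (algL_id X Lat) as HI.
  pose proof (algL_comp X Lat A A HA HA) as HAA.
  pose proof (algL_add X Lat hLat A _ HA HI) as HAI. cbv beta in HAI.
  pose proof (f_equal p (hid A HA x)) as E1.
  pose proof (f_equal p (hid _ HAI x)) as E2. cbv beta in E2.
  pose proof HA as ((Aa & _) & _).
  destruct (hdB _ HA) as (dAa & _). destruct (hdB _ HI) as (Da & _).
  fold D in Da, E1, E2.
  (* [delta] acts on functions, so the square of [A + I] is first rewritten as the sum of [A^2 + A]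
     and [A + I], to which additivity applies. *)
  assert (E : (fun y => vadd (A (vadd (A y) y)) (vadd (A y) y)) =
              (fun y => vadd ((fun z => vadd (A (A z)) (A z)) y)
                             ((fun z => vadd (A z) z) y))).
  { apply functional_extensionality. intro y. now rewrite Aa. }
  rewrite E in E2.
  rewrite (hdadd (fun z => vadd (A (A z)) (A z)) (fun z => vadd (A z) z)) in E2;
    [|now apply algL_add | exact HAI].
  rewrite (hdadd (fun z => A (A z)) A) in E2 by assumption.
  rewrite !(hdadd A (fun z => z)) in E2 by assumption. fold D in E2.
  repeat (rewrite Aa in E2 || rewrite dAa in E2 || rewrite Da in E2 ||
          rewrite ps in E2 || rewrite pa in E2).
  repeat (rewrite ps in E1 || rewrite pa in E1).
  rewrite !snat_add in *.
  apply (eq_of_sub E2), (eq_of_sub (eq_sym E1)). ring.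
Qed.

Context (hml : (1 <= m + l)%nat) (hnl : (1 <= n + l)%nat).

(** Write [p = m + l], [q = n + l]. Multiplying the identity by [p + q] and eliminating [delta A]
    and [delta (A^2)] leaves [D A^2] and [A^2 D] with coefficient [p q] and [A D A] with
    [m q + n p + l (p + q) = 2 p q]. The nonzero factors [p] and [q] cancel. *)
Lemma delta_id_double_commutator (A : X -> X) (x : X) :
  algL X Lat A ->
  vadd (D (A (A x))) (A (A (D x))) = vadd (A (D (A x))) (A (D (A x))).
Proof.
  intro HA. apply dual_separates. intros p Hp.
  pose proof (delta_linearized A (A x) p HA Hp) as E1.
  pose proof (delta_linearized A x _ HA (functional_comp X p A Hp (proj1 HA))) as E2.
  pose proof (delta_linearized _ x p (algL_comp X Lat A A HA HA) Hp) as E3.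
  cbv beta in E2, E3.
  pose proof (f_equal p (hid A HA x)) as E. fold D in E.
  destruct Hp as (pa & ps & _). rewrite !pa, !ps in E. rewrite !pa.
  set (s := snat k (m + l) + snat k (n + l)) in *.
  apply (smul_cancel _ _ _ (snat_neq0 k _ hml)).
  apply (smul_cancel _ _ _ (snat_neq0 k _ hnl)).
  apply (f_equal (smul k s)) in E.
  apply (f_equal (smul k (snat k m))) in E1.
  apply (f_equal (smul k (snat k n))) in E2.
  apply (f_equal (smul k (snat k (m + n + l)))) in E3.
  apply (eq_of_sub E), (eq_of_sub E1), (eq_of_sub E2), (eq_of_sub (eq_sym E3)).
  unfold s. rewrite !snat_add. ring.
Qed.

(** Once [D] and [A] commute at [x], both terms of [delta_linearized] are multiples of [D (A x)],
    with total coefficient [p + q]. *)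
Lemma delta_eq_of_commutes (A : X -> X) (x : X) :
  algL X Lat A -> D (A x) = A (D x) -> delta A x = D (A x).
Proof.
  intros HA HDA. apply dual_separates. intros p Hp.
  pose proof (delta_linearized A x p HA Hp) as E. rewrite <- HDA in E.
  rewrite <- snat_add in E.
  apply (smul_cancel (snat k (m + l + (n + l)))); [apply snat_neq0; lia|].
  rewrite E, (snat_add k (m + l)). ring.
Qed.

End JordanCentralizer.

Theorem theorem2p14 (k : Kind) (X : Banach k) (m n l : nat)
  (hml : (1 <= m + l)%nat) (hnl : (1 <= n + l)%nat)
  (Lat : (X -> Prop) -> Prop) (hLat : subspace_lattice X Lat)
  (hJ : (forall x, cspan X (Jset X Lat) x) \/
        (forall x, (forall K, Jset X Lat K -> Eminus X Lat K x) -> x = vzero X))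
  (delta : (X -> X) -> (X -> X))
  (hdB : forall A, algL X Lat A -> bounded_linear X (delta A))
  (hdadd : forall A B, algL X Lat A -> algL X Lat B ->
     forall x, delta (fun y => vadd (A y) (B y)) x = vadd (delta A x) (delta B x))
  (hdscale : forall (c : scal k) A, algL X Lat A ->
     forall x, delta (fun y => vscale c (A y)) x = vscale c (delta A x))
  (hid : forall A, algL X Lat A -> forall x,
     vscale (snat k (m + n + l)) (delta (fun y => A (A y)) x) =
     vadd (vscale (snat k m) (delta A (A x)))
       (vadd (vscale (snat k n) (A (delta A x)))
             (vscale (snat k l) (A (delta (fun y => y) (A x)))))) :
  forall A B, algL X Lat A -> algL X Lat B -> forall x,
    delta (fun y => A (B y)) x = delta A (B x) /\
    delta (fun y => A (B y)) x = A (delta B x).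
Proof.
  intros A B HA HB x.
  set (D := delta (fun y => y)).
  assert (HD : bounded_linear X D) by apply hdB, algL_id.
  assert (HDD : forall T, algL X Lat T -> forall z,
    vadd (D (T (T z))) (T (T (D z))) = vadd (T (D (T z))) (T (D (T z)))).
  { intros T HT z.
    exact (delta_id_double_commutator X m n l Lat hLat delta hdB hdadd hid hml hnl
      T z HT). }
  assert (Hcomm : forall T, algL X Lat T -> forall z, D (T z) = T (D z)).
  { intros T HT z. destruct hJ as [Hs|Hc].
    - now apply (commutes_of_cspan X Lat).
    - now apply (commutes_of_cap X Lat). }
  assert (Hdelta : forall T, algL X Lat T -> forall z, delta T z = D (T z)).
  { intros T HT z.
    apply (delta_eq_of_commutes X m n l Lat hLat delta hdB hdadd hid hml hnl T z HT).
    now apply Hcomm. }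
  (* All values of [delta] become left multiplication by [D]; the first equality is then trivial and
     the second moves [D] past [A]. *)
  rewrite (Hdelta _ (algL_comp X Lat A B HA HB)), !Hdelta by assumption.
  split; [reflexivity | now apply Hcomm].
Qed.
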